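(* Consider the Krasovskii-regularized Lur'e system $\dot x\in F(x)$, $y=Cx$, of the context, and suppose Assumptions 1 and 3 hold. Then the system is state finite-time stable (SFTS) if and only if $C$ is invertible (i.e., $p=n$ and $C$ is nonsingular).
   Context: System: $\dot x=Ax+Bu$, $y=Cx$, $u=-\boldsymbol\psi(y)$, $x\in\mathbb{R}^n$, $u,y\in\mathbb{R}^p$, $\boldsymbol\psi(y)=(\psi_1(y_1),\dots,\psi_p(y_p))$. Piecewise continuous: finitely many discontinuities on each bounded interval, continuous between them, finite one-sided limits. Krasovskii regularization: $\boldsymbol\Psi_i(s):=\bigcap_{\delta>0}\overline{\mathrm{co}}\,\psi_i(s+\delta[-1,1])$, $\boldsymbol\Psi(y):=\boldsymbol\Psi_1(y_1)\times\dots\times\boldsymbol\Psi_p(y_p)$, $F(x):=\{Ax-Bw:w\in\boldsymbol\Psi(Cx)\}$; solutions are absolutely continuous functions satisfying $\dot x(t)\in F(x(t))$ a.e. Assumption 1: for each $i$, $\psi_i$ is piecewise continuous and there is $\zeta_i\in(0,+\infty]$ with $\psi_i(s)(\psi_i(s)-\zeta_is)\le0$ for all $s$ (for $\zeta_i=+\infty$: $\psi_i(s)s\ge0$). Assumption 3: (i) there is a diagonal $\overline\Gamma>0$ with $\overline\Gamma CB+(CB)^\top\overline\Gamma>0$; (ii) the origin is globally asymptotically stable for $\dot x\in F(x)$ (all maximal solutions defined on $\mathbb{R}_{\ge0}$ and there is $\beta\in\mathcal{KL}$ with $|x(t)|\le\beta(|x(0)|,t)$ for all solutions and $t\ge0$);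 (iii) for each $i$, $\lim_{s\to0^+}\psi_i(s)>0$ and $\lim_{s\to0^-}\psi_i(s)<0$. SFTS: all solutions forward complete, the origin is globally asymptotically stable, and for each solution there is $T\in[0,\infty)$ with $x(t)=0$ for all $t\ge T$. *)

(* Defs.v *)
From mathcomp Require Import all_boot all_order all_algebra.
From mathcomp Require Import all_classical all_reals all_analysis.
Import Order.TTheory GRing.Theory Num.Theory numFieldNormedType.Exports.
Set Implicit Arguments. Unset Strict Implicit. Unset Printing Implicit Defensive.
Local Open Scope ring_scope.
Local Open Scope classical_set_scope.

Section LurieDefs.
Variable R : realType.

Definition enorm (n : nat) (v : 'cV[R]_n) : R := Num.sqrt (\sum_(i < n) v i 0 ^+ 2).

Definition pw_continuous (f : R -> R) : Prop :=
  (forall a b : R, finite_set [set s | a <= s <= b /\ ~ {for s, continuous f}]) /\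
  (forall s : R, exists l : R, f u @[u --> s^'+] --> l) /\
  (forall s : R, exists l : R, f u @[u --> s^'-] --> l).

Definition convex_set (K : set R) : Prop :=
  forall a b l : R, K a -> K b -> 0 <= l <= 1 -> K (l * a + (1 - l) * b).

Definition cl_conv_hull (S : set R) : set R :=
  \bigcap_(K in [set K : set R | S `<=` K /\ convex_set K /\ closed K]) K.

Definition kras (f : R -> R) (s : R) : set R :=
  \bigcap_(d in [set d : R | 0 < d]) cl_conv_hull (f @` [set u | `|u - s| <= d]).

Definition KrasF (n p : nat) (A : 'M[R]_n) (B : 'M[R]_(n, p)) (C : 'M[R]_(p, n))
  (psi : 'I_p -> R -> R) (x : 'cV[R]_n) : set 'cV[R]_n :=
  [set v | exists w : 'cV[R]_p,
      (forall i : 'I_p, kras (psi i) ((C *m x) i 0) (w i 0)) /\ v = A *m x - B *m w].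

Definition abs_cont_on (a b : R) (f : R -> R) : Prop :=
  forall e : R, 0 < e -> exists2 d : R, 0 < d &
    forall (k : nat) (u v : 'I_k -> R),
      (forall i, a <= u i /\ u i <= v i /\ v i <= b) ->
      (forall i j, i != j -> v i <= u j \/ v j <= u i) ->
      \sum_(i < k) (v i - u i) < d ->
      \sum_(i < k) `|f (v i) - f (u i)| < e.

Definition is_solution (n p : nat) (A : 'M[R]_n) (B : 'M[R]_(n, p)) (C : 'M[R]_(p, n))
  (psi : 'I_p -> R -> R) (T : \bar R) (x : R -> 'cV[R]_n) : Prop :=
  (0 < T)%E /\
  (forall t : R, 0 <= t -> (t%:E < T)%E -> forall i : 'I_n, abs_cont_on 0 t (fun s => x s i 0)) /\
  {ae (@lebesgue_measure R), forall t : R, 0 <= t -> (t%:E < T)%E ->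
      derivable x t 1 /\ KrasF A B C psi (x t) ('D_1 x t)}.

Definition is_maximal_solution (n p : nat) (A : 'M[R]_n) (B : 'M[R]_(n, p))
  (C : 'M[R]_(p, n)) (psi : 'I_p -> R -> R) (T : \bar R) (x : R -> 'cV[R]_n) : Prop :=
  is_solution A B C psi T x /\
  ~ (exists (T' : \bar R) (x' : R -> 'cV[R]_n),
        (T < T')%E /\ is_solution A B C psi T' x' /\
        (forall t : R, 0 <= t -> (t%:E < T)%E -> x' t = x t)).

Definition forward_complete (n p : nat) (A : 'M[R]_n) (B : 'M[R]_(n, p))
  (C : 'M[R]_(p, n)) (psi : 'I_p -> R -> R) : Prop :=
  forall T x, is_maximal_solution A B C psi T x -> T = +oo%E.

Definition classK (a : R -> R) : Prop :=
  a 0 = 0 /\ {within [set s : R | 0 <= s], continuous a} /\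
  (forall s1 s2 : R, 0 <= s1 -> s1 < s2 -> a s1 < a s2).

Definition classKL (beta : R -> R -> R) : Prop :=
  (forall t : R, 0 <= t -> classK (fun s => beta s t)) /\
  (forall s : R, 0 <= s ->
     (forall t1 t2 : R, 0 <= t1 -> t1 <= t2 -> beta s t2 <= beta s t1) /\
     beta s t @[t --> +oo] --> 0).

Definition GAS (n p : nat) (A : 'M[R]_n) (B : 'M[R]_(n, p)) (C : 'M[R]_(p, n))
  (psi : 'I_p -> R -> R) : Prop :=
  forward_complete A B C psi /\
  exists beta : R -> R -> R, classKL beta /\
    forall T x, is_solution A B C psi T x ->
      forall t : R, 0 <= t -> (t%:E < T)%E -> enorm (x t) <= beta (enorm (x 0)) t.

Definition SFTS (n p : nat) (A : 'M[R]_n) (B : 'M[R]_(n, p)) (C : 'M[R]_(p, n))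
  (psi : 'I_p -> R -> R) : Prop :=
  forward_complete A B C psi /\ GAS A B C psi /\
  forall T x, is_solution A B C psi T x ->
    exists Tc : R, 0 <= Tc /\ forall t : R, Tc <= t -> (t%:E < T)%E -> x t = 0.

Definition sector (z : \bar R) (f : R -> R) : Prop :=
  match z with
  | r%:E => forall s : R, f s * (f s - r * s) <= 0
  | +oo%E => forall s : R, 0 <= f s * s
  | -oo%E => False
  end.

Definition Assumption1 (p : nat) (psi : 'I_p -> R -> R) : Prop :=
  forall i : 'I_p, pw_continuous (psi i) /\
    exists z : \bar R, (0 < z)%E /\ sector z (psi i).

Definition posdef (p : nat) (M : 'M[R]_p) : Prop :=
  forall v : 'cV[R]_p, v != 0 -> 0 < (v^T *m M *m v) 0 0.

Definition Assumption3 (n p : nat) (A : 'M[R]_n) (B : 'M[R]_(n, p)) (C : 'M[R]_(p, n))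
  (psi : 'I_p -> R -> R) : Prop :=
  (exists G : 'M[R]_p, is_diag_mx G /\ posdef G /\
      posdef (G *m (C *m B) + (C *m B)^T *m G)) /\
  GAS A B C psi /\
  (forall i : 'I_p,
     (exists l : R, 0 < l /\ psi i u @[u --> (0 : R)^'+] --> l) /\
     (exists l : R, l < 0 /\ psi i u @[u --> (0 : R)^'-] --> l)).

End LurieDefs.

(* Main.v *)
(* Let l_i^+ > 0 > l_i^- be the one-sided limits of psi_i at 0.

   If C is injective, take V = sum_i G_ii max (l_i^+ y_i, l_i^- y_i) with y = C x.
   Along a solution, almost every zero of y_i is a zero of its derivative, since
   the other zeros are isolated; so V' = wt^T G y' almost everywhere, with wt close
   to the input w near the origin.  There the part - w^T G C B w dominates, because
   G C B + (C B)^T G > 0 and some |w_i| is bounded below as long as x <> 0.  Hence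
   V' <= - c < 0 until x reaches 0, and V cannot grow afterwards.

   Conversely C B is invertible, so p <= n, and p < n would make ker C nontrivial.
   On ker C the matrix S = (1 - B (C B)^-1 C) A is invariant, and near the origin
   S x belongs to F x because the input (C B)^-1 C A x is small.  A real or complex
   eigenvector of S on ker C gives a motion exp (t S) x_0 which never vanishes, and
   stability keeps it small when x_0 is, so that it is a solution. *)
Require Import Defs.
From mathcomp Require Import all_boot all_order all_algebra.
From mathcomp Require Import all_classical all_reals all_analysis.
From mathcomp Require Import ring lra complex.
Import Order.TTheory GRing.Theory Num.Theory numFieldNormedType.Exports.
Set Implicit Arguments. Unset Strict Implicit. Unset Printing Implicit Defensive.
Local Open Scope ring_scope.
Local Open Scope classical_set_scope.

(** * Real induction and monotonicity of absolutely continuous functions *)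

(** The step carries [P] across [c] from any nearby point on its left. Applied at the supremum of
    the points satisfying [P], it would pass beyond that supremum unless the supremum is [b]. *)
Lemma real_induction (R : realType) (P : R -> Prop) (a b : R) :
  a <= b -> P a ->
  (forall c, a <= c <= b -> exists2 d, 0 < d &
     forall s t, a <= s -> s <= c -> c <= t -> t <= b -> c - s < d -> t - c < d ->
       P s -> P t) ->
  P b.
Proof.
move=> ab Pa step.
pose S := [set s | a <= s <= b /\ P s].
have Sa : S a by split=> //; rewrite lexx ab.
have ubS : ubound S b by move=> s [/andP[_ sb] _].
have supS : has_sup S by split; [exists a | exists b].
have ac : a <= sup S by apply: ub_le_sup => //; exists b.
have cb : sup S <= b by apply: ge_sup => //; exists a.
have [|d d0 Hd] := step (sup S); first by rewrite ac cb.
have [s Ss sc] := sup_adherent d0 supS.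
have sle : s <= sup S by apply: ub_le_sup => //; exists b.
have [/andP[as_ sb] Ps] := Ss.
pose t := Num.min b (sup S + d / 2).
have tb : t <= b by rewrite /t ge_min lexx.
have ct : sup S <= t by rewrite /t le_min cb /=; lra.
have tc : t <= sup S + d / 2 by rewrite /t ge_min lexx orbT.
have Pt : P t by apply: (Hd s t) => //; lra.
have : t <= sup S.
  by apply: ub_le_sup => //; [exists b | split=> //; rewrite tb andbT; lra].
rewrite /t ge_min => /orP[bc|]; last by lra.
suff <- : t = b by [].
by apply/eqP; rewrite eq_le tb; lra.
Qed.

(** Applied at two points [s <= c <= t], this quotient-free form estimates the increment of [f] over
    an interval around [c]. *)
Lemma is_derive_straddle (R : realType) (f : R -> R) (c df e : R) :
  is_derive c 1 f df -> 0 < e ->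
  exists2 d, 0 < d & forall t, `|t - c| < d -> `|f t - f c - df * (t - c)| <= e * `|t - c|.
Proof.
move=> Hf e0.
have Hc : h^-1 *: (f (h *: 1 + c) - f c) @[h --> 0^'] --> df.
  by have := @ex_derive _ _ _ _ _ _ _ Hf; rewrite -(@derive_val _ _ _ _ _ _ _ Hf).
move/cvgrPdist_le : Hc => /(_ e e0)[/= d d0 Hd].
exists d => // t td.
have [->|tc] := eqVneq t c; first by rewrite !subrr mulr0 subr0 normr0 mulr0.
have tc0 : t - c != 0 by rewrite subr_eq0.
have := Hd (t - c); rewrite /ball_/= sub0r normrN => /(_ td tc0).
rewrite [(t - c) *: 1]mulr1 subrK => H.
have -> : f t - f c - df * (t - c) = - (t - c) * (df - (t - c)^-1 * (f t - f c)).
  by field.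
by rewrite normrM normrN mulrC ler_wpM2r.
Qed.

(** Lists replace indexed families so that intervals can be appended one at a time in the real
    induction below. *)
Lemma abs_cont_seq (R : realType) (a b e : R) (f : R -> R) :
  abs_cont_on a b f -> 0 < e ->
  exists2 d : R, 0 < d & forall l : seq (R * R),
    all (fun p => (a <= p.1) && (p.1 <= p.2) && (p.2 <= b)) l ->
    pairwise (fun p q : R * R => p.2 <= q.1) l ->
    \sum_(p <- l) (p.2 - p.1) < d ->
    \sum_(p <- l) `|f p.2 - f p.1| < e.
Proof.
move=> acf e0; have [d d0 Hd] := acf e e0; exists d => // l al pl sl.
pose u (i : 'I_(size l)) := (nth (0, 0) l i).1.
pose v (i : 'I_(size l)) := (nth (0, 0) l i).2.
have := Hd (size l) u v.
rewrite -(big_mkord xpredT (fun i => (nth (0, 0) l i).2 - (nth (0, 0) l i).1)).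
rewrite -(big_mkord xpredT (fun i => `|f (nth (0, 0) l i).2 - f (nth (0, 0) l i).1|)).
rewrite -(big_nth (0, 0) xpredT (fun p : R * R => p.2 - p.1)).
rewrite -(big_nth (0, 0) xpredT (fun p : R * R => `|f p.2 - f p.1|)); apply=> //.
- move=> i; move/allP : al => /(_ (nth (0, 0) l i)); rewrite mem_nth//.
  by move=> /(_ isT)/andP[/andP[]].
- move=> i j ij; move/(pairwiseP (0, 0)) : pl => pl.
  have [ltij|ltji|eqij] := ltgtP (i : nat) (j : nat).
  + by left; apply: pl => //; rewrite inE.
  + by right; apply: pl => //; rewrite inE.
  + by move/negP : ij; case; apply/eqP/val_inj.
Qed.

Lemma negligible_open_cover (R : realType) (N : set R) (d : R) :
  (@lebesgue_measure R).-negligible N -> 0 < d ->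
  exists U : set R, [/\ open U, N `<=` U & (lebesgue_measure U < d%:E)%E].
Proof.
move=> [M [mM M0 NM]] d0.
have [|U [oU MU UM]] := @lebesgue_regularity_outer R M d mM _ d0.
  by rewrite [X in (X < _)%E]M0.
exists U; split=> //; first exact: subset_trans MU.
have -> : U = M `|` (U `\` M) by rewrite setDUK.
have mU : measurable U by exact: measurable_realfun.open_measurable.
rewrite measureU//; [|exact: measurableD|by rewrite setDIK].
by rewrite [X in (X + _)%E]M0 add0e.
Qed.

(** A covering argument that avoids integration. The exceptional set lies in an open set of small
    measure, where absolute continuity controls the increments; elsewhere the derivative keeps the
    slope below any [e > 0]. Real induction joins the two kinds of steps. *)
Lemma abs_cont_nonincreasing (R : realType) (a b : R) (f : R -> R) :
  a <= b -> abs_cont_on a b f ->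
  {ae (@lebesgue_measure R), forall t, a <= t <= b ->
     exists2 df, df <= 0 & is_derive t 1 f df} ->
  f b <= f a.
Proof.
move=> ab acf nulN; apply/ler_addgt0Pr => e0 e0_gt0.
(* The slope contributes at most [e * (b - a)] and the cover at most [e], which add up to [e0]. *)
pose e := e0 / (b - a + 1).
have e_gt0 : 0 < e by rewrite divr_gt0//; lra.
have [d d0 Hd] := abs_cont_seq acf e_gt0.
have [U [oU NU Ud]] := negligible_open_cover nulN d0.
have mU : measurable U by exact: measurable_realfun.open_measurable.
(* [l] collects the steps of the induction taken inside the small cover [U] of the
   exceptional set; absolute continuity bounds their total contribution. *)
pose P s := exists l : seq (R * R),
  [/\ all (fun p => (a <= p.1) && (p.1 <= p.2) && (p.2 <= s)) l,
      pairwise (fun p q : R * R => p.2 <= q.1) l,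
      ((\sum_(p <- l) (p.2 - p.1))%:E <= lebesgue_measure (U `&` `]a, s]))%E &
      f s - f a <= e * (s - a) + \sum_(p <- l) `|f p.2 - f p.1|].
suff [l [al pl ml fl]] : P b.
  have sl : \sum_(p <- l) (p.2 - p.1) < d.
    rewrite -lte_fin (le_lt_trans ml)// (le_lt_trans _ Ud)//.
    by apply: le_measure; rewrite ?inE//; apply: measurableI => //.
  have := Hd l al pl sl.
  have : e * (b - a) + e = e0 by rewrite /e; field; lra.
  lra.
apply: (@real_induction _ P a b ab).
  by exists [::]; split; rewrite ?big_nil//= !subrr mulr0 addr0.
move=> c acb.
(* Inside [U], the interval from [s] to [t] joins the list, and its length is paid for by the
   measure of [U] between [s] and [t]. *)
have [cU|cU] := pselect (U c).
  have [/= r r0 Hr] : nbhs c U by exact: open_nbhs_nbhs.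
  exists r => // s t as_ sc ct tb csr tcr [l [al pl ml fl]].
  exists (rcons l (s, t)); split.
  - rewrite all_rcons /= as_ lexx (le_trans sc ct)/=.
    by apply: sub_all al => p /andP[->/= /le_trans]; apply; lra.
  - rewrite pairwise_rcons pl andbT; apply/allP => p pl'.
    by move/allP : al => /(_ _ pl')/andP[].
  - rewrite -cats1 big_cat big_seq1/=.
    have stU : `]s, t] `<=` U.
      by move=> z /=; rewrite in_itv/= => /andP[sz zt]; apply: Hr => /=; rewrite ltr_norml; lra.
    have -> : U `&` `]a, t] = (U `&` `]a, s]) `|` `]s, t].
      rewrite predeqE => z /=; rewrite !in_itv/=; split.
        move=> [Uz /andP[az zt]]; have [zs|sz] := leP z s.
          by left; rewrite az.
        by right; rewrite zt.
      move=> [[Uz /andP[az zs]]|/andP[sz zt]]; first by split=> //; rewrite az; lra.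
      by split; [apply: stU; rewrite /= in_itv/= sz | lra].
    rewrite measureU//; [|exact: measurableI|].
      have lm : ((t - s)%:E <= lebesgue_measure `]s, t]%classic)%E.
        rewrite lebesgue_measure_itv/= lte_fin; case: ltP => // ts.
        by rewrite lee_fin; lra.
      by rewrite EFinD; exact: (leeD ml lm).
    rewrite predeqE => z; split=> //= -[[_]]; rewrite !in_itv/=; lra.
  - rewrite -cats1 big_cat big_seq1/=.
    have := ler_norm (f t - f s).
    have : e * (s - a) <= e * (t - a) by rewrite ler_pM2l//; lra.
    lra.
(* Outside [U] the derivative exists and is nonpositive; the list is unchanged and the increment
   from [s] to [t] is at most [e * (t - s)]. *)
have [df df0 fdf] : exists2 df, df <= 0 & is_derive c 1 f df.
  by move: acb; apply: contrapT => cN; apply: cU; apply: NU.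
have [r r0 Hr] := is_derive_straddle fdf e_gt0.
exists r => // s t as_ sc ct tb csr tcr [l [al pl ml fl]].
exists l; split=> //.
- by apply: sub_all al => p /andP[->/= /le_trans]; apply; lra.
- apply: (le_trans ml); apply: le_measure; rewrite ?inE.
  + exact: measurableI.
  + exact: measurableI.
  + apply: setIS => z /=; rewrite !in_itv/=; lra.
- have /Hr : `|t - c| < r by rewrite ger0_norm; lra.
  have /Hr : `|s - c| < r by rewrite ler0_norm; lra.
  rewrite [`|t - c|]ger0_norm ?[`|s - c|]ler0_norm; [|lra|lra].
  rewrite !ler_norml => /andP[H1 _] /andP[_ H2].
  have H3 : df * (t - s) <= 0 by rewrite mulr_le0_ge0//; lra.
  move: fl H1 H2 H3; rewrite !mulrBr mulrN mulrBr; lra.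
Qed.

(** A zero with nonzero derivative is isolated, hence is the first zero after some rational, and
    each rational has at most one such zero. *)
Lemma countable_transversal_zeros (R : realType) (y : R -> R) :
  countable [set t | y t = 0 /\ exists2 d, d != 0 & is_derive t 1 y d].
Proof.
pose Z (q : rat) := [set t : R | y t = 0 /\ ratr q < t /\
  forall s, ratr q < s < t -> y s != 0].
apply: (@sub_countable _ _ _ (\bigcup_(q in [set: rat]) Z q)).
  apply/subset_card_le => t [yt0 [d d0 yd]].
  (* With this tolerance [y s] stays at distance at least [|d| / 2 * |s - t|] from 0 near [t]. *)
  have nd : 0 < `|d| / 2 by rewrite divr_gt0// normr_gt0.
  have [r r0 Hr] := is_derive_straddle yd nd.
  have [|q] := @rat_in_itvoo R (t - r) t; first by lra.
  rewrite in_itv/= => /andP[qr qt]; exists q => //; split=> //; split=> // s /andP[qs st].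
  have : `|s - t| < r by rewrite ltr0_norm; lra.
  move=> /Hr; rewrite yt0 subr0; apply: contraTneq => ->.
  rewrite sub0r normrN normrM -ltNge ltr_pM2r; last by rewrite normr_gt0; lra.
  by have : 0 < `|d| by [rewrite normr_gt0]; lra.
apply: bigcup_countable => [|q _]; first exact: countableP.
have [->|/set0P[t Zt]] := eqVneq (Z q) set0; first exact: countable0.
apply: (@sub_countable _ _ _ [set t]); last exact: countable1.
apply/subset_card_le => s Zs /=.
move: Zt Zs => [yt [qt Ht]] [ys [qs Hs]].
have [st|ts|//] := ltgtP s t.
- by have := Ht s; rewrite qs st ys eqxx => /(_ isT).
- by have := Hs t; rewrite qt ts yt eqxx => /(_ isT).
Qed.

(** * Closure properties of absolute continuity *)

Lemma abs_cont_lipschitz_comp (R : realType) (a b L : R) (f g : R -> R) :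
  abs_cont_on a b f ->
  (forall s t, a <= s <= b -> a <= t <= b -> `|g t - g s| <= L * `|f t - f s|) ->
  abs_cont_on a b g.
Proof.
move=> acf gf e e0.
have L0 : 0 < `|L| + 1 by rewrite ltr_wpDl.
have [d d0 Hd] := acf (e / (`|L| + 1)) (divr_gt0 e0 L0).
exists d => // k u v auvb duv suv.
have : (`|L| + 1) * \sum_(i < k) `|f (v i) - f (u i)| < e.
  by rewrite mulrC -ltr_pdivlMr//; exact: Hd.
apply: le_lt_trans; rewrite mulr_sumr; apply: ler_sum => i _.
have [au [uv vb]] := auvb i.
apply: (le_trans (gf _ _ _ _)); [lra|lra|].
by apply: ler_wpM2r => //; apply: (le_trans (ler_norm _)); rewrite lerDl.
Qed.

Lemma abs_cont_lipschitz (R : realType) (a b L : R) (g : R -> R) :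
  (forall s t, a <= s <= b -> a <= t <= b -> `|g t - g s| <= L * `|t - s|) ->
  abs_cont_on a b g.
Proof.
apply: (@abs_cont_lipschitz_comp _ a b L id) => e e0; exists e => // k u v auvb _ /=.
apply: le_lt_trans; apply: ler_sum => i _; rewrite ger0_norm//.
by have [_ []] := auvb i; lra.
Qed.

Lemma abs_cont_add (R : realType) (a b : R) (f g : R -> R) :
  abs_cont_on a b f -> abs_cont_on a b g -> abs_cont_on a b (fun t => f t + g t).
Proof.
move=> acf acg e e0.
have e2 : 0 < e / 2 by lra.
have [d d0 Hd] := acf _ e2; have [d' d'0 Hd'] := acg _ e2.
exists (Num.min d d') => [|k u v auvb duv]; first by rewrite lt_min d0.
rewrite lt_min => /andP[sd sd'].
have := Hd k u v auvb duv sd; have := Hd' k u v auvb duv sd'.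
suff : \sum_(i < k) `|f (v i) + g (v i) - (f (u i) + g (u i))| <=
   \sum_(i < k) `|f (v i) - f (u i)| + \sum_(i < k) `|g (v i) - g (u i)| by lra.
rewrite -big_split /=; apply: ler_sum => i _.
by rewrite opprD addrACA ler_normD.
Qed.

Lemma abs_cont_sum (R : realType) (a b : R) (I : Type) (r : seq I) (f : I -> R -> R) :
  (forall i, abs_cont_on a b (f i)) -> abs_cont_on a b (fun t => \sum_(i <- r) f i t).
Proof.
move=> acf; elim: r => [|i r IH].
  apply: (@abs_cont_lipschitz _ a b 0) => s t _ _.
  by rewrite !big_nil subrr normr0 mul0r.
under eq_fun do rewrite big_cons.
exact: (abs_cont_add (acf i) IH).
Qed.

(** * Matrix estimates in the maximum norm *)

Lemma mx_entry_le_norm (R : realType) (m n : nat) (M : 'M[R]_(m, n)) i j :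
  `|M i j| <= `|M|.
Proof. by rewrite [leRHS]/Num.Def.normr/= mx_normrE; exact: (le_bigmax _ _ (i, j)). Qed.

Lemma mx_norm_le (R : realType) (m n : nat) (M : 'M[R]_(m, n)) (e : R) :
  0 <= e -> (forall i j, `|M i j| <= e) -> `|M| <= e.
Proof.
by move=> e0 Me; rewrite [leLHS]/Num.Def.normr/= mx_normrE; apply: bigmax_le => // -[].
Qed.

Lemma mx_norm_tr (R : realType) (m n : nat) (M : 'M[R]_(m, n)) : `|M^T| = `|M|.
Proof.
apply/eqP; rewrite eq_le; apply/andP; split; apply: mx_norm_le => // i j.
  by rewrite mxE; exact: mx_entry_le_norm.
by have := mx_entry_le_norm M^T j i; rewrite mxE.
Qed.

Lemma mulmx_norm_le (R : realType) (m n p : nat) (M : 'M[R]_(m, n)) :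
  exists2 K, 0 <= K & forall N : 'M[R]_(n, p), `|M *m N| <= K * `|N|.
Proof.
exists (\sum_(j < n) `|M|) => [|N]; first exact: sumr_ge0.
have K0 : 0 <= (\sum_(j < n) `|M|) * `|N| by rewrite mulr_ge0// sumr_ge0.
apply: mx_norm_le => // i j; rewrite mxE mulr_suml.
apply: (le_trans (ler_norm_sum _ _ _)); apply: ler_sum => k _.
by rewrite normrM ler_pM// mx_entry_le_norm.
Qed.

Lemma bilinear_norm_le (R : realType) (m n : nat) (M : 'M[R]_(m, n)) :
  exists2 K, 0 <= K & forall (u : 'cV[R]_m) (v : 'cV[R]_n),
    `|(u^T *m M *m v) 0 0| <= K * `|u| * `|v|.
Proof.
have [K K0 HK] := mulmx_norm_le 1 M.
exists (\sum_(j < m) K) => [|u v]; first exact: sumr_ge0.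
rewrite -mulmxA mxE !mulr_suml.
apply: (le_trans (ler_norm_sum _ _ _)); apply: ler_sum => k _.
rewrite normrM mulrAC mulrC ler_pM//.
  exact: le_trans (mx_entry_le_norm _ _ _) (HK v).
by rewrite -(mx_norm_tr u) mx_entry_le_norm.
Qed.

Lemma continuous_quadratic (R : realType) (p : nat) (M : 'M[R]_p) :
  continuous (fun u : 'rV[R]_p => (u *m M *m u^T) 0 0).
Proof.
have -> : (fun u : 'rV[R]_p => (u *m M *m u^T) 0 0) =
    (fun u : 'rV[R]_p => \sum_j \sum_i (u 0 i * M i j * u 0 j)).
  apply/funext => v; rewrite mxE; apply: eq_bigr => j _.
  by rewrite !mxE mulr_suml.
apply: (@continuous_big R _ +%R 0 xpredT (@add_continuous R)) => j _.
apply: (@continuous_big R _ +%R 0 xpredT (@add_continuous R)) => i _ u.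
have cu k : v 0 k @[v --> u] --> u 0 k by exact: coord_continuous.
exact: (cvgM (cvgMr_tmp (cu i)) (cu j)).
Qed.

(** The constant is the minimum of the form on the compact unit sphere; homogeneity of degree two
    extends the bound to every vector. *)
Lemma posdef_lower_bound (R : realType) (p : nat) (M : 'M[R]_p) :
  posdef M -> exists2 c, 0 < c & forall v : 'cV[R]_p, c * `|v| ^+ 2 <= (v^T *m M *m v) 0 0.
Proof.
move=> pM; pose A := [set u : 'rV[R]_p | `|u| = 1].
(* An empty sphere means that every vector is zero, so any constant will do. *)
have [A0|/set0P A0] := eqVneq A set0.
  exists 1 => // v; have [->|v0] := eqVneq v 0.
    by rewrite normr0 expr0n mulr0 mulmx0 mxE.
  have : A (`|v|^-1 *: v^T).
    by rewrite /A /= normrZ mx_norm_tr normrV ?unitfE ?normr_eq0// normr_id mulVf ?normr_eq0.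
  by rewrite A0.
have Acl : closed A.
  apply: (@preimage_closed _ _ (fun u : 'rV[R]_p => `|u|) [set 1]) => [u _|].
    exact: norm_continuous.
  exact: closed_eq.
have Abd : bounded_set A.
  by exists 1; split=> // x x1 u /= ->; exact: ltW.
have cA := bounded_closed_compact Abd Acl.
have [u uA Hu] := EVT_min_rV A0 cA (continuous_subspaceT (@continuous_quadratic R p M)).
have u1 : `|u| = 1 by move: uA; rewrite inE.
have u0 : u^T != 0.
  apply/eqP => /(congr1 trmx); rewrite trmxK trmx0 => uE.
  by move: u1; rewrite uE normr0; lra.
exists ((u *m M *m u^T) 0 0).
  by have := pM _ u0; rewrite trmxK.
move=> v; have [->|v0] := eqVneq v 0.
  by rewrite normr0 expr0n mulr0 mulmx0 mxE.
have nv : 0 < `|v| by rewrite normr_gt0.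
have Av : (`|v|^-1 *: v^T) \in A.
  by rewrite inE /A /= normrZ mx_norm_tr normrV ?unitfE ?normr_eq0// normr_id mulVf ?normr_eq0.
have := Hu _ Av.
rewrite linearZ/= trmxK -scalemxAr -!scalemxAl !mxE mulrA -invfM -expr2.
by rewrite mulrC ler_pdivlMr// exprn_gt0.
Qed.

(** * The Krasovskii regularization near zero *)

(** The segment from [lo] to [hi] is one of the closed convex sets being intersected. *)
Lemma kras_bounds (R : realType) (f : R -> R) (s lo hi d w : R) :
  0 < d -> (forall u, `|u - s| <= d -> lo <= f u <= hi) -> kras f s w -> lo <= w <= hi.
Proof.
move=> d0 fb /(_ d d0) /(_ `[lo, hi]); rewrite /= in_itv/=; apply; split=> [|].
  by move=> _ [u /= us <-] /=; rewrite in_itv/=; exact: fb.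
split=> [x y l /=|]; last exact: interval_closed.
rewrite !in_itv/= => /andP[lx xh] /andP[ly yh] /andP[l0 l1].
have l1' : 0 <= 1 - l by lra.
move: lx xh ly yh; rewrite -(subr_ge0 lo x) -(subr_ge0 x) -(subr_ge0 lo y) -(subr_ge0 y).
move=> lx xh ly yh; have := (mulr_ge0 l0 lx, mulr_ge0 l0 xh, mulr_ge0 l1' ly, mulr_ge0 l1' yh).
move=> [[[H1 H2] H3] H4]; change (lo <= l * x + (1 - l) * y <= hi).
by apply/andP; split; lra.
Qed.

(** A closed set containing the values of [f] near 0 contains both one-sided limits, and by
    convexity the segment between them. *)
Lemma kras_itv (R : realType) (f : R -> R) (lneg lpos w : R) :
  f u @[u --> (0 : R)^'+] --> lpos -> f u @[u --> (0 : R)^'-] --> lneg ->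
  lneg <= w <= lpos -> kras f 0 w.
Proof.
move=> fp fn /andP[nw wp] d /= d0 K [fK [cK clK]].
have Kp : K lpos.
  apply: (@closed_cvg _ _ _ (at_right_proper_filter 0) f K clK _ _ fp).
  near=> u; apply: fK; exists u => //=; rewrite subr0 ger0_norm;
    last by near: u; exact: nbhs_right_ge.
  by near: u; exact: nbhs_right_le.
have Kn : K lneg.
  apply: (@closed_cvg _ _ _ (at_left_proper_filter 0) f K clK _ _ fn).
  near=> u; apply: fK; exists u => //=; rewrite subr0 ler0_norm;
    last by near: u; exact: nbhs_left_le.
  rewrite lerNl; near: u; apply: nbhs_left_ge; lra.
have [E|pn] := eqVneq lpos lneg.
  by have -> : w = lpos by lra.
have d1 : 0 < lpos - lneg by rewrite subr_gt0 lt_neqAle eq_sym pn; lra.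
have -> : w = (w - lneg) / (lpos - lneg) * lpos + (1 - (w - lneg) / (lpos - lneg)) * lneg.
  by field; lra.
apply: cK => //; rewrite divr_ge0//=; [|lra|lra].
by rewrite ler_pdivrMr//; lra.
Unshelve. all: by end_near. Qed.

Lemma is_derive_straddleP (R : realType) (f : R -> R) (c df : R) :
  (forall e, 0 < e ->
   exists2 d, 0 < d & forall t, `|t - c| < d -> `|f t - f c - df * (t - c)| <= e * `|t - c|) ->
  is_derive c 1 f df.
Proof.
move=> Hf.
have Hc : h^-1 *: (f (h *: 1 + c) - f c) @[h --> 0^'] --> df.
  apply/cvgrPdist_le => e e0; have [d d0 Hd] := Hf e e0.
  exists d => // h /=; rewrite sub0r normrN => hd h0.
  have := Hd (h *: 1 + c); rewrite [h *: 1]mulr1 addrK => /(_ hd).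
  have -> : f (h + c) - f c - df * h = - h * (df - h^-1 * (f (h + c) - f c)) by field.
  by rewrite normrM normrN mulrC ler_pM2r// normr_gt0.
apply: DeriveDef; first by apply/cvg_ex; exists df.
exact/cvg_lim.
Qed.

(** The maximum has a kink only where [y] vanishes. There [dy = 0] makes the increments of both
    branches negligible, so the derivative is 0 for any value of [w]. *)
Lemma is_derive_max_linear (R : realType) (y : R -> R) (t dy lneg lpos w : R) :
  lneg <= lpos -> is_derive t 1 y dy -> (y t = 0 -> dy = 0) ->
  (0 < y t -> w = lpos) -> (y t < 0 -> w = lneg) ->
  is_derive t 1 (fun s => Num.max (lpos * y s) (lneg * y s)) (w * dy).
Proof.
move=> ll yd y0 ypos yneg.
have maxpos s : 0 <= y s -> Num.max (lpos * y s) (lneg * y s) = lpos * y s.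
  by move=> ys; apply/max_idPl; rewrite ler_wpM2r.
have maxneg s : y s <= 0 -> Num.max (lpos * y s) (lneg * y s) = lneg * y s.
  by move=> ys; apply/max_idPr; rewrite ler_wnM2r.
pose L := `|lpos| + `|lneg| + 1.
have L0 : 0 < L by rewrite ltr_wpDl// addr_ge0.
have Lpos : `|lpos| <= L by rewrite /L -addrA lerDl addr_ge0.
have Lneg : `|lneg| <= L by rewrite /L addrAC lerDr addr_ge0.
have [d1 d10 Hd1] := is_derive_straddle yd (ltr01 : 0 < 1 :> R).
apply: is_derive_straddleP => e e0.
have [d d0 Hd] := is_derive_straddle yd (divr_gt0 e0 L0).
have lip l s : `|l| <= L -> `|s - t| < d ->
    `|l * y s - l * y t - l * dy * (s - t)| <= e * `|s - t|.
  move=> lL std; rewrite -mulrA -!mulrBr normrM.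
  apply: (le_trans (ler_pM _ _ lL (Hd s std))) => //.
  by rewrite mulrA [L * _]mulrCA mulfV ?gt_eqF// mulr1.
have cont s : `|s - t| < d1 -> `|y s - y t| <= (`|dy| + 1) * `|s - t|.
  move=> std; have := Hd1 s std.
  have := ler_normD (y s - y t - dy * (s - t)) (dy * (s - t)).
  by rewrite subrK normrM mulrDl; lra.
have D0 : 0 < `|dy| + 1 by rewrite ltr_wpDl.
have [yt|yt|yt] := ltgtP (y t) 0.
(* The last radius keeps [|y s - y t|] below [|y t|], so that [y] keeps its sign and one branch of
   the maximum stays active. *)
- exists (Num.min d (Num.min d1 (- y t / (`|dy| + 1)))) => [|s].
    by rewrite !lt_min d0 d10 divr_gt0//; lra.
  rewrite !lt_min => /andP[sd /andP[sd1]]; rewrite ltr_pdivlMr// mulrC => sy.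
  have := cont s sd1; rewrite ler_norml => /andP[_ ys].
  by rewrite !maxneg ?(yneg yt); [exact: lip|lra|lra].
- exists (Num.min d (Num.min d1 (y t / (`|dy| + 1)))) => [|s].
    by rewrite !lt_min d0 d10 divr_gt0//; lra.
  rewrite !lt_min => /andP[sd /andP[sd1]]; rewrite ltr_pdivlMr// mulrC => sy.
  have := cont s sd1; rewrite ler_norml => /andP[ys _].
  by rewrite !maxpos ?(ypos yt); [exact: lip|lra|lra].
- exists d => // s std; rewrite (y0 yt) mulr0 mul0r subr0.
  rewrite (maxpos t) ?yt// mulr0 subr0.
  have := lip _ s Lpos std; have := lip _ s Lneg std.
  by rewrite (y0 yt) yt !(mulr0, mul0r, subr0); case: (leP (lpos * y s)).
Qed.

Lemma min_fin_gt0 (R : realType) (I : finType) (d : I -> R) :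
  (forall i, 0 < d i) -> exists2 e, 0 < e & forall i, e <= d i.
Proof.
move=> d0; exists (\big[Num.min/1]_i d i); first by apply: lt_bigmin.
by move=> i; apply: bigmin_le_cond.
Qed.

Lemma right_limit_dist (R : realType) (f : R -> R) (l e : R) :
  f u @[u --> (0 : R)^'+] --> l -> 0 < e ->
  exists2 d, 0 < d & forall s, 0 < s < d -> `|f s - l| <= e.
Proof.
move=> /cvgrPdist_le fl e0; have [d /= d0 Hd] := fl e e0.
exists d => // s /andP[s0 sd]; rewrite distrC; apply: Hd => //=.
by rewrite sub0r normrN gtr0_norm.
Qed.

Lemma left_limit_dist (R : realType) (f : R -> R) (l e : R) :
  f u @[u --> (0 : R)^'-] --> l -> 0 < e ->
  exists2 d, 0 < d & forall s, - d < s < 0 -> `|f s - l| <= e.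
Proof.
move=> /cvgrPdist_le fl e0; have [d /= d0 Hd] := fl e e0.
exists d => // s /andP[sd s0]; rewrite distrC; apply: Hd => //=.
by rewrite sub0r normrN ltr0_norm//; lra.
Qed.

Lemma kras_dist (R : realType) (f : R -> R) (s l e d w : R) :
  0 < d -> (forall u, `|u - s| <= d -> `|f u - l| <= e) -> kras f s w -> `|w - l| <= e.
Proof.
move=> d0 fe kw.
suff /andP[H1 H2] : l - e <= w <= l + e by rewrite ler_norml; lra.
by apply: (kras_bounds d0 _ kw) => u /fe; rewrite ler_norml; lra.
Qed.

(** Everything used about [psi], with constants uniform in [i]. Close to 0 but on one side of it,
    small windows around [s] do not meet 0, so regularized values stay near the one-sided limit. *)
Lemma sliding_limits (R : realType) (p : nat) (psi : 'I_p -> R -> R) :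
  (forall i : 'I_p,
     (exists l : R, 0 < l /\ psi i u @[u --> (0 : R)^'+] --> l) /\
     (exists l : R, l < 0 /\ psi i u @[u --> (0 : R)^'-] --> l)) ->
  exists lpos lneg : 'I_p -> R, exists2 m, 0 < m &
  [/\ forall i, m <= lpos i /\ lneg i <= - m,
      forall i w, lneg i <= w <= lpos i -> kras (psi i) 0 w &
      forall e, 0 < e -> exists2 d, 0 < d & forall i s w, kras (psi i) s w ->
        (0 < s < d -> `|w - lpos i| <= e) /\ (- d < s < 0 -> `|w - lneg i| <= e)].
Proof.
move=> Hpsi.
have [lpos Hpos] := choice (fun i => (Hpsi i).1).
have [lneg Hneg] := choice (fun i => (Hpsi i).2).
have [mp mp0 Hmp] := min_fin_gt0 (fun i => (Hpos i).1).
have [|mn mn0 Hmn] := @min_fin_gt0 R _ (fun i => - lneg i).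
  by move=> i; have [] := Hneg i; lra.
exists lpos, lneg, (Num.min mp mn); first by rewrite lt_min mp0.
split=> [i|i w lw|e e0].
- split; first by rewrite ge_min Hmp.
  by rewrite lerNr ge_min Hmn orbT.
- exact: kras_itv (Hpos i).2 (Hneg i).2 lw.
have Ep i := right_limit_dist (Hpos i).2 e0.
have En i := left_limit_dist (Hneg i).2 e0.
pose dp i := sval (cid2 (Ep i)); pose dn i := sval (cid2 (En i)).
have [|d1 d10 Hd1] := @min_fin_gt0 R _ dp; first by move=> i; rewrite /dp; case: cid2.
have [|d2 d20 Hd2] := @min_fin_gt0 R _ dn; first by move=> i; rewrite /dn; case: cid2.
exists (Num.min d1 d2) => [|i s w kw]; first by rewrite lt_min d10.
split=> /andP[].
- move=> s0; rewrite lt_min => /andP[sd1 _].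
  have := Hd1 i; rewrite /dp; case: cid2 => /= d _ Hd d1d.
  (* The window of radius [h] around [s] lies strictly between 0 and [d]. *)
  have [h h0 /andP[hs hd]] : exists2 h, 0 < h & (h < s) && (s + h < d).
    exists (Num.min s (d - s) / 2); first by rewrite divr_gt0// lt_min; lra.
    have : Num.min s (d - s) <= s by rewrite ge_min lexx.
    have : Num.min s (d - s) <= d - s by rewrite ge_min lexx orbT.
    by lra.
  by apply: (kras_dist h0 _ kw) => u us; apply: Hd; move: us; rewrite ler_norml; lra.
- move=> sd s0; have {sd} sd2 : - d2 < s.
    by apply: le_lt_trans sd; rewrite lerN2 ge_min lexx orbT.
  have := Hd2 i; rewrite /dn; case: cid2 => /= d _ Hd d2d.
  have [h h0 /andP[hs hd]] : exists2 h, 0 < h & (h < - s) && (- d < s - h).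
    exists (Num.min (- s) (d + s) / 2); first by rewrite divr_gt0// lt_min; lra.
    have : Num.min (- s) (d + s) <= - s by rewrite ge_min lexx.
    have : Num.min (- s) (d + s) <= d + s by rewrite ge_min lexx orbT.
    by lra.
  by apply: (kras_dist h0 _ kw) => u us; apply: Hd; move: us; rewrite ler_norml; lra.
Qed.

(** * Quadratic decay estimate and the Lyapunov function *)

(** Since [G] is symmetric, the two summands are transposes of each other, and a scalar equals its
    transpose. *)
Lemma quadratic_sym_part (R : realType) (p : nat) (G N : 'M[R]_p) (w : 'cV[R]_p) :
  is_diag_mx G ->
  (w^T *m (G *m N + N^T *m G) *m w) 0 0 = 2 * (w^T *m G *m (N *m w)) 0 0.
Proof.
move=> dG; have GT : G^T = G.
  apply/matrixP => i j; rewrite mxE; have [->//|ij] := eqVneq i j.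
  by have /is_diag_mxP dG' := dG; rewrite !dG'// 1?eq_sym.
rewrite mulmxDr mulmxDl mxE mulr_natl mulr2n; congr (_ + _); first by rewrite !mulmxA.
rewrite -[LHS](mxE trmx_key (fun i j => (w^T *m (N^T *m G) *m w) j i)).
by rewrite -/(trmx _) !trmx_mul !trmxK GT !mulmxA.
Qed.

(* The factor [wt] multiplying [G *m C *m x'] in [V'] is only close to the actual
   input [w], but [|w| >= m] lets the quadratic term in [w] absorb both the error
   and the drift. *)
Lemma lyapunov_decay (R : realType) (n p : nat) (A : 'M[R]_n) (B : 'M[R]_(n, p))
  (C : 'M[R]_(p, n)) (G : 'M[R]_p) (m : R) :
  is_diag_mx G -> posdef (G *m (C *m B) + (C *m B)^T *m G) -> 0 < m ->
  exists2 r, 0 < r & exists2 c, 0 < c &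
    forall (x : 'cV[R]_n) (w wt : 'cV[R]_p), `|x| <= r -> `|wt - w| <= r -> m <= `|w| ->
      (wt^T *m G *m (C *m (A *m x - B *m w))) 0 0 <= - c.
Proof.
move=> dG pM m0.
have [c c0 Hc] := posdef_lower_bound pM.
have [K1 K10 HK1] := bilinear_norm_le (G *m C *m A).
have [K2 K20 HK2] := bilinear_norm_le (G *m C *m B).
(* Since [r <= m <= |w|], the drift and error terms total at most [(2 * K1 + K2) * r * |w|], hence
   at most [c * |w| ^+ 2 / 8], against a quadratic gain of at least [c * |w| ^+ 2 / 2]. *)
pose r := Num.min m (c * m / (8 * (2 * K1 + K2 + 1))).
have K0 : 0 < 8 * (2 * K1 + K2 + 1) by lra.
have r0 : 0 < r by rewrite lt_min m0 divr_gt0// mulr_gt0.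
have rm : r <= m by rewrite ge_min lexx.
have rK : r * (8 * (2 * K1 + K2 + 1)) <= c * m.
  by rewrite -ler_pdivlMr// ge_min lexx orbT.
exists r => //; exists (c * m ^+ 2 / 4); first by rewrite divr_gt0// mulr_gt0// exprn_gt0.
move=> x w wt xr wr mw.
pose e := wt - w.
have -> : wt = w + e by rewrite addrC subrK.
have E : (w + e)^T *m G *m (C *m (A *m x - B *m w)) =
   w^T *m (G *m C *m A) *m x + e^T *m (G *m C *m A) *m x
   - (w^T *m G *m (C *m B *m w) + e^T *m (G *m C *m B) *m w).
  by rewrite linearD/= !mulmxDl !mulmxBr !mulmxA opprD addrACA.
rewrite E !mxE.
have := Hc w; rewrite quadratic_sym_part//.
have := HK1 w x; have := HK1 e x; have := HK2 e w.
move: (`|w|) mw (`|x|) xr (`|e|) (wr : `|e| <= r) (normr_ge0 w) (normr_ge0 x) (normr_ge0 e).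
move=> W mw X xr Ee er W0 X0 E0.
rewrite !ler_norml !mxE => /andP[h1 _] /andP[_ h2] /andP[_ h3] h4.
have W1 : 0 < W by lra.
have b1 : K2 * Ee * W <= K2 * r * W by rewrite ler_pM2r// ler_wpM2l.
have b2 : K1 * Ee * X <= K1 * W * r.
  by apply: ler_pM => //; [exact: mulr_ge0|apply: ler_wpM2l => //; lra].
have b3 : K1 * W * X <= K1 * W * r by apply: ler_wpM2l => //; exact: mulr_ge0.
have b4 : r * (8 * (2 * K1 + K2 + 1)) * W <= c * m * W by rewrite ler_pM2r.
have b5 : c * m * W <= c * W ^+ 2 by rewrite expr2 mulrA ler_pM2r// ler_pM2l.
have b6 : c * m ^+ 2 <= c * m * W by rewrite expr2 mulrA ler_pM2l// mulr_gt0.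
have b7 : 0 <= r * W by rewrite mulr_ge0// ltW.
have b8 : 0 <= c * m ^+ 2 by rewrite mulr_ge0 ?exprn_ge0// ltW.
lra.
Qed.

Lemma mx_norm_le_enorm (R : realType) (n : nat) (v : 'cV[R]_n) : `|v| <= enorm v.
Proof.
apply: mx_norm_le => [|i j]; first exact: sqrtr_ge0.
rewrite (ord1 j) -sqrtr_sqr ler_sqrt; last by apply: sumr_ge0 => k _; exact: sqr_ge0.
by rewrite (bigD1 i)//= lerDl sumr_ge0// => k _; exact: sqr_ge0.
Qed.

Lemma diag_form (R : realType) (p : nat) (G : 'M[R]_p) (w z : 'cV[R]_p) :
  is_diag_mx G -> (w^T *m G *m z) 0 0 = \sum_i G i i * (w i 0 * z i 0).
Proof.
move=> /is_diag_mxP dG; rewrite mxE; apply: eq_bigr => j _.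
rewrite mxE (bigD1 j)//= big1 ?addr0 => [|k kj]; last by rewrite dG// mulr0.
by rewrite mxE mulrCA mulrA.
Qed.

Lemma posdef_diag_gt0 (R : realType) (p : nat) (G : 'M[R]_p) i : posdef G -> 0 < G i i.
Proof.
move=> /(_ (delta_mx i 0)).
rewrite trmx_delta -rowE -colE !mxE; apply.
by apply/eqP => /matrixP/(_ i 0); rewrite !mxE !eqxx; apply/eqP; rewrite oner_eq0.
Qed.

Lemma is_derive_mulmx_entry (R : realType) (n p : nat) (C : 'M[R]_(p, n))
  (x : R -> 'cV[R]_n) (t : R) i :
  derivable x t 1 -> is_derive t 1 (fun s => (C *m x s) i 0) ((C *m 'D_1 x t) i 0).
Proof.
move=> dx; have dxj := (derivable_mxP x t 1).1 dx.
have -> : (fun s => (C *m x s) i 0) = \sum_j (C i j \*: (fun s => x s j 0)).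
  by apply/funext => s; rewrite mxE fct_sumE.
rewrite mxE; apply: is_derive_sum => j.
rewrite derive_mx// mxE; apply: is_deriveZ.
exact/derivableP.
Qed.

Section LyapunovFunction.
Variables (R : realType) (n p : nat) (C : 'M[R]_(p, n)) (G : 'M[R]_p).
Variables lneg lpos : 'I_p -> R.

(** When [lneg i < 0 < lpos i], each maximum is the integral from 0 to the output [y_i] of the relay
    with values [lpos i] and [lneg i], as in a Lur'e-Postnikov function. *)
Definition lyap (x : 'cV[R]_n) : R :=
  \sum_i G i i * Num.max (lpos i * (C *m x) i 0) (lneg i * (C *m x) i 0).

Hypotheses (dG : is_diag_mx G) (pG : posdef G).
Hypotheses (lpos0 : forall i, 0 < lpos i) (lneg0 : forall i, lneg i < 0).

Lemma lyap_term_ge0 i (y : R) : 0 <= Num.max (lpos i * y) (lneg i * y).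
Proof.
have := lpos0 i; have := lneg0 i; rewrite le_max => ln lp.
have [y0|/ltW y0] := leP 0 y; first by rewrite mulr_ge0// ltW.
by rewrite orbC mulr_le0// ltW.
Qed.

Lemma lyap_ge0 x : 0 <= lyap x.
Proof.
apply: sumr_ge0 => i _; rewrite mulr_ge0 ?lyap_term_ge0//.
exact/ltW/posdef_diag_gt0.
Qed.

Lemma lyap_eq0 x : lyap x <= 0 -> C *m x = 0.
Proof.
move=> Vx; apply/matrixP => i j; rewrite (ord1 j) [RHS]mxE.
have t0 k : 0 <= G k k * Num.max (lpos k * (C *m x) k 0) (lneg k * (C *m x) k 0).
  by rewrite mulr_ge0 ?lyap_term_ge0//; exact/ltW/posdef_diag_gt0.
have : lyap x = 0 by apply/eqP; rewrite eq_le Vx lyap_ge0.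
move/eqP; rewrite /lyap psumr_eq0// => /allP/(_ i); rewrite mem_index_enum => /(_ isT) /=.
rewrite mulf_eq0 gt_eqF ?posdef_diag_gt0//= => /eqP M0.
have : lpos i * (C *m x) i 0 <= 0 by rewrite -M0 le_max lexx.
have : lneg i * (C *m x) i 0 <= 0 by rewrite -M0 le_max lexx orbT.
rewrite nmulr_rle0// pmulr_rle0// => h1 h2.
by apply/eqP; rewrite eq_le h1 h2.
Qed.

Lemma abs_cont_lyap (a b : R) (x : R -> 'cV[R]_n) :
  (forall i, abs_cont_on a b (fun s => x s i 0)) ->
  abs_cont_on a b (fun s => lyap (x s)).
Proof.
move=> acx; apply: abs_cont_sum => i.
have acy : abs_cont_on a b (fun s => (C *m x s) i 0).
  have -> : (fun s => (C *m x s) i 0) = (fun s => \sum_j C i j * x s j 0).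
    by apply/funext => s; rewrite mxE.
  apply: (@abs_cont_sum _ a b _ _ (fun j s => C i j * x s j 0)) => j.
  apply: (abs_cont_lipschitz_comp (L := `|C i j|) (acx j)) => s t _ _.
  by rewrite -mulrBr normrM.
apply: (abs_cont_lipschitz_comp (L := `|G i i| * (`|lpos i| + `|lneg i|)) acy) => s t _ _.
rewrite -mulrBr normrM -mulrA ler_wpM2l// mulrDl.
set y := (C *m x t) i 0; set z := (C *m x s) i 0.
have lip (l : R) : `|l * y - l * z| <= `|l| * `|y - z| by rewrite -mulrBr normrM.
have := mulr_ge0 (normr_ge0 (lpos i)) (normr_ge0 (y - z)).
have := mulr_ge0 (normr_ge0 (lneg i)) (normr_ge0 (y - z)).
have := lip (lpos i); have := lip (lneg i); rewrite !ler_norml.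
by case: (leP (lpos i * y)); case: (leP (lpos i * z)); lra.
Qed.

(** The vector [w] is free in the coordinates where the output vanishes; later it takes the value of
    the actual input there. *)
Lemma is_derive_lyap (x : R -> 'cV[R]_n) (t : R) (w : 'cV[R]_p) :
  derivable x t 1 ->
  (forall i, (C *m x t) i 0 = 0 -> (C *m 'D_1 x t) i 0 = 0) ->
  (forall i, (0 < (C *m x t) i 0 -> w i 0 = lpos i) /\ ((C *m x t) i 0 < 0 -> w i 0 = lneg i)) ->
  is_derive t 1 (fun s => lyap (x s)) ((w^T *m G *m (C *m 'D_1 x t)) 0 0).
Proof.
move=> dx y0 wy; rewrite diag_form//.
have -> : (fun s => lyap (x s)) = \sum_i (G i i \*: (fun s =>
    Num.max (lpos i * (C *m x s) i 0) (lneg i * (C *m x s) i 0))).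
  by apply/funext => s; rewrite fct_sumE.
apply: is_derive_sum => i; apply: is_deriveZ.
apply: is_derive_max_linear (wy i).1 (wy i).2.
- exact/ltW/(lt_trans (lneg0 i)).
- exact: is_derive_mulmx_entry.
- exact: y0.
Qed.

End LyapunovFunction.

(** * Finite-time convergence for injective [C] *)

Lemma abs_cont_on_subl (R : realType) (a a' b : R) (f : R -> R) :
  a <= a' -> abs_cont_on a b f -> abs_cont_on a' b f.
Proof.
move=> aa acf e e0; have [d d0 Hd] := acf e e0; exists d => // k u v auvb.
by apply: Hd => i; have [au uvb] := auvb i; split=> //; exact: le_trans au.
Qed.

Lemma GAS_eventually_small (R : realType) (n p : nat) (A : 'M[R]_n) (B : 'M[R]_(n, p))
  (C : 'M[R]_(p, n)) (psi : 'I_p -> R -> R) (x : R -> 'cV[R]_n) (r : R) :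
  GAS A B C psi -> is_solution A B C psi +oo%E x -> 0 < r ->
  exists2 t0, 0 <= t0 & forall t, t0 <= t -> `|x t| <= r.
Proof.
move=> [_ [beta [[_ KL] Hb]]] solx r0.
have e0 : 0 <= enorm (x 0) by exact: sqrtr_ge0.
have [_ /cvgrPdist_le/(_ r r0)[M [_ HM]]] := KL _ e0.
exists (Num.max 0 (M + 1)) => [|t]; first by rewrite le_max lexx.
rewrite ge_max => /andP[t0 Mt].
apply: (le_trans (mx_norm_le_enorm _)); apply: (le_trans (Hb _ _ solx t t0 (ltry t))).
by have := HM t; rewrite sub0r normrN => H; apply: le_trans (ler_norm _) (H _); lra.
Qed.

Lemma countable_negligible (R : realType) (Z : set R) :
  countable Z -> (@lebesgue_measure R).-negligible Z.
Proof.
move=> cZ; exists Z; split=> //; last exact: countable_lebesgue_measure0.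
by apply: countable_measurable => // t; exact: measurable_set1.
Qed.

Section FiniteTimeConvergence.
Variables (R : realType) (n p : nat) (A : 'M[R]_n) (B : 'M[R]_(n, p)).
Variables (C : 'M[R]_(p, n)) (psi : 'I_p -> R -> R).
Hypothesis C_inj : forall z : 'cV[R]_n, C *m z = 0 -> z = 0.

Lemma lyap_decrease : Assumption3 A B C psi ->
  exists V : 'cV[R]_n -> R, exists2 r, 0 < r & exists2 c, 0 < c &
  [/\ forall z, 0 <= V z, forall z, V z <= 0 -> z = 0, V 0 <= 0,
    forall a b (x : R -> 'cV[R]_n), (forall i, abs_cont_on a b (fun s => x s i 0)) ->
       abs_cont_on a b (fun s => V (x s)) &
    forall (x : R -> 'cV[R]_n) t, `|x t| <= r -> derivable x t 1 ->
      KrasF A B C psi (x t) ('D_1 x t) ->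
      (forall i, (C *m x t) i 0 = 0 -> (C *m 'D_1 x t) i 0 = 0) ->
      exists dV, [/\ is_derive t 1 (fun s => V (x s)) dV, dV <= 0 & x t != 0 -> dV <= - c]].
Proof.
move=> [[G [dG [pG pM]]] [_ Hpsi]].
have [lpos [lneg [m m0 [lm _ knear]]]] := sliding_limits Hpsi.
have m2 : 0 < m / 2 by lra.
have [r r0 [c c0 decay]] := lyapunov_decay A dG pM m2.
(* The bound [r] serves the decay estimate; [m / 2] leaves [|w i 0| >= m / 2] at each nonzero
   output. *)
have e0 : 0 < Num.min r (m / 2) by rewrite lt_min r0.
have [d d0 Hd] := knear _ e0.
have [K K0 HK] := mulmx_norm_le 1 C.
have K1 : 0 < K + 1 by lra.
have lpos0 i : 0 < lpos i by have [] := lm i; lra.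
have lneg0 i : lneg i < 0 by have [] := lm i; lra.
(* The radius [d / (K + 1)] keeps all outputs smaller than [d], where the inputs are close to the
   limits. *)
exists (lyap C G lneg lpos), (Num.min r (d / (K + 1))); first by rewrite lt_min r0 divr_gt0.
exists c => //; split.
- exact: lyap_ge0.
- by move=> z /(lyap_eq0 pG lpos0 lneg0); exact: C_inj.
- by rewrite /lyap big1// => i _; rewrite mulmx0 mxE !mulr0 maxxx mulr0.
- exact: abs_cont_lyap.
move=> x t; rewrite le_min => /andP[xr xd] dx [w [kw Dx]] y0.
have yd i : `|(C *m x t) i 0| < d.
  apply: (le_lt_trans (mx_entry_le_norm _ _ _)); apply: (le_lt_trans (HK _)).
  move: xd; rewrite ler_pdivlMr// => xd.
  have [->|x0] := eqVneq `|x t| 0; first by rewrite mulr0.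
  have : 0 < `|x t| by rewrite lt_neqAle eq_sym x0 normr_ge0.
  by lra.
(* [wt] copies the actual input at zero outputs and takes the one-sided limit elsewhere: it is close
   to [w] and also gives the derivative of [lyap]. *)
pose wt : 'cV[R]_p := \col_i (if (C *m x t) i 0 == 0 then w i 0
  else if 0 < (C *m x t) i 0 then lpos i else lneg i).
have wtd i : wt i 0 = if (C *m x t) i 0 == 0 then w i 0
  else if 0 < (C *m x t) i 0 then lpos i else lneg i by rewrite [LHS]mxE.
have wtE i : (0 < (C *m x t) i 0 -> wt i 0 = lpos i) /\ ((C *m x t) i 0 < 0 -> wt i 0 = lneg i).
  rewrite wtd; split=> y; first by rewrite gt_eqF// y.
  by rewrite lt_eqF// ltNge ltW.
have [Hp Hn] : (forall i, 0 < (C *m x t) i 0 -> `|w i 0 - lpos i| <= Num.min r (m / 2)) /\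
    (forall i, (C *m x t) i 0 < 0 -> `|w i 0 - lneg i| <= Num.min r (m / 2)).
  split=> i y; have := yd i; rewrite ltr_norml => /andP[y1 y2].
    by apply: (Hd _ _ _ (kw i)).1; rewrite y.
  by apply: (Hd _ _ _ (kw i)).2; rewrite y y1.
have wtw : `|wt - w| <= Num.min r (m / 2).
  apply: mx_norm_le => [|i j]; first exact: ltW.
  have -> : (wt - w) i j = wt i 0 - w i 0 by rewrite (ord1 j) [LHS]mxE [X in _ + X]mxE.
  have [y|y|y] := ltgtP ((C *m x t) i 0) 0.
  - by rewrite (wtE i).2// distrC Hn.
  - by rewrite (wtE i).1// distrC Hp.
  - by rewrite wtd y eqxx subrr normr0 ltW.
have decr : x t != 0 -> (wt^T *m G *m (C *m 'D_1 x t)) 0 0 <= - c.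
  move=> x0; rewrite Dx; apply: decay => //.
    by apply: le_trans wtw _; rewrite ge_min lexx.
  have [i yi] : exists i, (C *m x t) i 0 != 0.
    apply: contrapT => ny; move/eqP : x0; apply; apply: C_inj.
    apply/matrixP => i j; rewrite (ord1 j) [RHS]mxE.
    by apply: contrapT => /eqP yi; apply: ny; exists i.
  apply: le_trans (mx_entry_le_norm w i 0).
  have [mp mn] := lm i; have em : Num.min r (m / 2) <= m / 2 by rewrite ge_min lexx orbT.
  move: yi; rewrite neq_lt => /orP[/Hn|/Hp]; rewrite ler_norml => /andP[h1 h2].
    by rewrite ler0_norm; lra.
  by rewrite ger0_norm; lra.
exists ((wt^T *m G *m (C *m 'D_1 x t)) 0 0); split=> //.
  exact: is_derive_lyap.
have [x0|/decr] := eqVneq (x t) 0; last by lra.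
rewrite diag_form// big1// => i _.
by rewrite y0 ?mulr0// x0 mulmx0 mxE.
Qed.

Lemma finite_time_convergence (x : R -> 'cV[R]_n) :
  Assumption3 A B C psi -> is_solution A B C psi +oo%E x ->
  exists Tc, 0 <= Tc /\ forall t, Tc <= t -> x t = 0.
Proof.
move=> H3 solx; have [_ [hGAS _]] := H3.
have [V [r r0 [c c0 [V0 Vz V00 acV dV]]]] := lyap_decrease H3.
have [t0 t00 xr] := GAS_eventually_small hGAS solx r0.
have [_ [acx aex]] := solx.
have aeV : {ae (@lebesgue_measure R), forall t, t0 <= t ->
    exists dV, [/\ is_derive t 1 (fun s => V (x s)) dV, dV <= 0 & x t != 0 -> dV <= - c]}.
  (* For each of the finitely many outputs, the times of transversal zeros form a countable, hence
     null, set. *)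
  have aeZ : {ae (@lebesgue_measure R), forall t i,
      ~ ((C *m x t) i 0 = 0 /\ exists2 d, d != 0 & is_derive t 1 (fun s => (C *m x s) i 0) d)}.
    apply: filter_forall => i.
    have := countable_negligible (countable_transversal_zeros (fun s => (C *m x s) i 0)).
    by apply: negligibleS => t /= /contrapT.
  apply: (@filterS2 _ _ (ae_filter_ringOfSetsType lebesgue_measure) _ _ _ _ aex aeZ)
    => t sol nZ tt0.
  have tge0 := le_trans t00 tt0.
  have [dx Kx] := sol tge0 (ltry t).
  apply: dV => // [|i y0]; first exact: xr.
  apply: contrapT => /eqP y1; apply: (nZ i); split=> //; exists ((C *m 'D_1 x t) i 0) => //.
  exact: is_derive_mulmx_entry.
have acVab a b : 0 <= a -> a <= b -> abs_cont_on a b (fun s => V (x s)).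
  move=> a0 ab; apply: acV => i; apply: (abs_cont_on_subl a0).
  exact: acx (le_trans a0 ab) (ltry b) i.
(* Decay at rate [c] up to [T1] would give [V (x T1) <= - c]; the additional unit of time makes this
   a contradiction. *)
pose T1 := t0 + V (x t0) / c + 1.
have T1t0 : t0 <= T1 by rewrite /T1; have := divr_ge0 (V0 (x t0)) (ltW c0); lra.
exists T1; split; first exact: le_trans T1t0.
have [s st0 [sT1 xs]] : exists2 s, t0 <= s & s <= T1 /\ x s = 0.
  apply: contrapT => nx.
  have : V (x T1) + c * T1 <= V (x t0) + c * t0.
    apply: (@abs_cont_nonincreasing R t0 T1 (fun s => V (x s) + c * s)) => //.
      apply: abs_cont_add; first exact: acVab.
      by apply: (@abs_cont_lipschitz _ _ _ `|c|) => s t _ _; rewrite -mulrBr normrM.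
    apply: (@filterS _ _ (ae_filter_ringOfSetsType lebesgue_measure) _ _ _ aeV)
      => t aet /andP[tt0 tT1].
    have [d [Vd _ dc]] := aet tt0.
    exists (d + c).
      have : x t != 0 by apply/eqP => xt; apply: nx; exists t.
      by move=> /dc; lra.
    apply: is_deriveD.
    by have := @is_deriveZ _ _ _ id c t 1 1 _; rewrite [c *: 1]mulr1; apply.
  have := V0 (x T1); rewrite /T1 !mulrDr mulr1 mulrCA divff ?gt_eqF//.
  by lra.
move=> t T1t; apply: Vz; apply: (@le_trans _ _ (V (x s))); last by rewrite xs.
have s0 := le_trans t00 st0; have st := le_trans sT1 T1t.
apply: (abs_cont_nonincreasing st (acVab _ _ s0 st)).
apply: (@filterS _ _ (ae_filter_ringOfSetsType lebesgue_measure) _ _ _ aeV) => u aeu /andP[su _].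
by have [d [Vd d0 _]] := aeu (le_trans st0 su); exists d.
Qed.

End FiniteTimeConvergence.

(** * Invariant directions in the kernel of [C] *)

(** [u] and [v] are the real and imaginary parts of an eigenvector over the algebraically closed
    field [R[i]], for the eigenvalue [a + i b]. *)
Lemma complex_eigenpair (R : rcfType) (k : nat) (D : 'M[R]_k) : (0 < k)%N ->
  exists a b (u v : 'rV[R]_k),
  [/\ u *m D = a *: u - b *: v, v *m D = b *: u + a *: v & (u != 0) || (v != 0)].
Proof.
move=> k0; pose f := real_complex R.
have [l /eigenvalueP[z zD z0]] := eigenvalue_closed (map_mx f D) k0.
have ReD (F : 'I_k -> R[i]) : complex.Re (\sum_i F i) = \sum_i complex.Re (F i).
  by apply: (big_morph (@complex.Re R)) => // -[? ?] [? ?].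
have ImD (F : 'I_k -> R[i]) : complex.Im (\sum_i F i) = \sum_i complex.Im (F i).
  by apply: (big_morph (@complex.Im R)) => // -[? ?] [? ?].
exists (complex.Re l), (complex.Im l), (map_mx (@complex.Re R) z), (map_mx (@complex.Im R) z).
split.
- apply/rowP => j; move/rowP/(_ j)/(congr1 (@complex.Re R)) : zD; rewrite !mxE ReD.
  have -> : complex.Re (l * z 0 j) =
      complex.Re l * complex.Re (z 0 j) - complex.Im l * complex.Im (z 0 j).
    by case: l => ? ?; case: (z 0 j).
  move=> <-; apply: eq_bigr => i _; rewrite !mxE.
  by case: (z 0 i) => x y /=; rewrite mulr0 subr0.
- apply/rowP => j; move/rowP/(_ j)/(congr1 (@complex.Im R)) : zD; rewrite !mxE ImD.
  have -> : complex.Im (l * z 0 j) =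
      complex.Im l * complex.Re (z 0 j) + complex.Re l * complex.Im (z 0 j).
    by case: l => ? ?; case: (z 0 j) => ? ? /=; rewrite addrC.
  move=> <-; apply: eq_bigr => i _; rewrite !mxE.
  by case: (z 0 i) => x y /=; rewrite mulr0 add0r.
- rewrite -negb_and; apply: contra z0 => /andP[/eqP zr /eqP zi]; apply/eqP/rowP => j.
  move/rowP/(_ j) : zr; move/rowP/(_ j) : zi; rewrite !mxE.
  by case: (z 0 j) => x y /= -> ->.
Qed.

(** [C *m S = 0] puts the image of [S] inside the kernel of [C], which is therefore invariant. [D]
    represents the restriction of [S] in a basis of that kernel, whose dimension is positive because
    [p < n]. *)
Lemma invariant_eigenpair (R : rcfType) (n p : nat) (S : 'M[R]_n) (C : 'M[R]_(p, n)) :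
  C *m S = 0 -> (p < n)%N ->
  exists a b (u v : 'cV[R]_n),
  [/\ S *m u = a *: u - b *: v, S *m v = b *: u + a *: v, C *m u = 0, C *m v = 0 &
      (u != 0) || (v != 0)].
Proof.
move=> CS pn; pose K := row_base (kermx C^T).
have KC : K *m C^T = 0.
  by apply/sub_kermxP; rewrite eq_row_base.
have k0 : (0 < \rank (kermx C^T))%N.
  rewrite mxrank_ker mxrank_tr subn_gt0; exact: leq_ltn_trans (rank_leq_row C) pn.
have /submxP[D KD] : (K *m S^T <= K)%MS.
  by rewrite eq_row_base; apply/sub_kermxP; rewrite -mulmxA -trmx_mul CS trmx0 mulmx0.
have [a [b [u [v [uD vD uv]]]]] := complex_eigenpair D k0.
have Kinj (w : 'rV_(\rank (kermx C^T))) : (w *m K)^T = 0 -> w = 0.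
  move/(congr1 trmx); rewrite trmxK trmx0 => wK.
  by apply: (row_free_inj (row_base_free (kermx C^T))); rewrite mul0mx.
have SK (w : 'rV_(\rank (kermx C^T))) : S *m (w *m K)^T = (w *m D *m K)^T.
  by rewrite -[S]trmxK -trmx_mul -(mulmxA w K) KD mulmxA.
have CK (w : 'rV_(\rank (kermx C^T))) : C *m (w *m K)^T = 0.
  by apply: trmx_inj; rewrite trmx_mul trmxK -mulmxA KC mulmx0 trmx0.
exists a, b, (u *m K)^T, (v *m K)^T; split=> //.
- by rewrite SK uD mulmxBl -!scalemxAl linearB/= !linearZ.
- by rewrite SK vD mulmxDl -!scalemxAl linearD/= !linearZ.
- apply: contraTT uv; rewrite !negb_or !negbK => /andP[/eqP/Kinj -> /eqP/Kinj ->].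
  by rewrite eqxx.
Qed.

Lemma unitmx_inj (F : fieldType) (p : nat) (M : 'M[F]_p) :
  (forall v : 'cV[F]_p, M *m v = 0 -> v = 0) -> M \in unitmx.
Proof.
move=> Minj; rewrite -unitmx_tr -row_free_unit -kermx_eq0; apply/eqP/row_matrixP => i.
rewrite row0; apply: trmx_inj; rewrite trmx0; apply: Minj.
by apply: trmx_inj; rewrite trmx_mul trmxK -row_mul mulmx_ker row0 trmx0.
Qed.

Lemma posdef_sym_unit (R : realType) (p : nat) (G N : 'M[R]_p) :
  is_diag_mx G -> posdef (G *m N + N^T *m G) -> N \in unitmx.
Proof.
move=> dG pN; apply: unitmx_inj => v Nv; apply: contrapT => /eqP /pN.
by rewrite quadratic_sym_part// Nv mulmx0 mxE mulr0 ltxx.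
Qed.

(** The derivative is bounded on the compact interval, so the mean value theorem gives a Lipschitz
    constant. *)
Lemma abs_cont_C1 (R : realType) (a b : R) (f df : R -> R) :
  (forall t : R, is_derive t 1 f (df t)) -> continuous df -> abs_cont_on a b f.
Proof.
move=> fd cdf; have [ab|ba] := leP a b; last first.
  by apply: (@abs_cont_lipschitz _ a b 0) => s t; lra.
have cn : continuous (fun t => `|df t|).
  by move=> t; apply: (cvg_comp _ _ (cdf t)); exact: norm_continuous.
have [c _ Hc] := EVT_max ab (continuous_subspaceT cn).
have cf : continuous f.
  by move=> t; have /derivable1_diffP/differentiable_continuous := @ex_derive _ _ _ _ _ _ _ (fd t).
have lip s t : a <= s -> s <= t -> t <= b -> `|f t - f s| <= `|df c| * `|t - s|.
  move=> as_ st tb.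
  have [d dst ->] := MVT_segment st (fun x _ => fd x) (continuous_subspaceT cf).
  rewrite normrM ler_wpM2r//; apply: Hc.
  by move: dst; rewrite !in_itv/=; lra.
apply: (@abs_cont_lipschitz _ a b `|df c|) => s t sab tab.
have [st|/ltW ts] := leP s t; first by apply: lip; lra.
by rewrite distrC (distrC t); apply: lip; lra.
Qed.

(** * Explicit motions of a linear flow *)

Section LinearFlow.
Variables (R : realType) (n : nat) (a b : R) (u v : 'cV[R]_n).

(* Real part of [exp((a + i b) t) (u + i v)]. *)
Definition spiral (t : R) : 'cV[R]_n :=
  expR (a * t) *: (cos (b * t) *: u - sin (b * t) *: v).

Lemma is_derive_spiral (i : 'I_n) (t : R) :
  is_derive t 1 (fun s => spiral s i 0)
    (expR (a * t) * (a * (cos (b * t) * u i 0 - sin (b * t) * v i 0)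
       - b * (sin (b * t) * u i 0 + cos (b * t) * v i 0))).
Proof.
have lin (c : R) : is_derive t 1 ( *%R c) c.
  by have := @is_deriveZ _ _ _ id c t 1 1 _; rewrite [c *: 1]mulr1; apply.
have He := is_derive1_comp (is_derive_expR (a * t)) (lin a).
have Hc := is_deriveZ (u i 0) (is_derive1_comp (is_derive_cos (b * t)) (lin b)).
have Hs := is_deriveZ (v i 0) (is_derive1_comp (is_derive_sin (b * t)) (lin b)).
have := is_deriveM He (is_deriveB Hc Hs).
have -> : (expR \o *%R a) * (u i 0 \*: (cos \o *%R b) - v i 0 \*: (sin \o *%R b)) =
    (fun s => spiral s i 0).
  apply/funext => s; rewrite /spiral !mxE /=.
  rewrite -[LHS]/(expR (a * s) * (u i 0 * cos (b * s) - v i 0 * sin (b * s))).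
  by ring.
move=> H; apply: is_derive_eq H _.
rewrite -[LHS]/(expR (a * t) * (u i 0 * (- sin (b * t) * b) - v i 0 * (cos (b * t) * b)) +
  (u i 0 * cos (b * t) - v i 0 * sin (b * t)) * (expR (a * t) * a)).
by ring.
Qed.

Lemma derivable_spiral (t : R) : derivable spiral t 1.
Proof.
apply/derivable_mxP => i j; rewrite (ord1 j).
exact: (@ex_derive _ _ _ _ _ _ _ (is_derive_spiral i t)).
Qed.

Lemma derive_spiral (S : 'M[R]_n) (t : R) :
  S *m u = a *: u - b *: v -> S *m v = b *: u + a *: v -> 'D_1 spiral t = S *m spiral t.
Proof.
move=> Su Sv; apply/matrixP => i j; rewrite (ord1 j) derive_mx; last exact: derivable_spiral.
rewrite [LHS]mxE (@derive_val _ _ _ _ _ _ _ (is_derive_spiral i t)).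
rewrite /spiral -scalemxAr mulmxBr -!scalemxAr Su Sv !mxE.
by ring.
Qed.

Lemma spiral_mulmx0 (p : nat) (C : 'M[R]_(p, n)) t :
  C *m u = 0 -> C *m v = 0 -> C *m spiral t = 0.
Proof. by move=> Cu Cv; rewrite -scalemxAr mulmxBr -!scalemxAr Cu Cv !scaler0 subrr scaler0. Qed.

End LinearFlow.

Lemma abs_cont_spiral (R : realType) (n : nat) (a b c d : R) (u v : 'cV[R]_n) i :
  abs_cont_on c d (fun s => spiral a b u v s i 0).
Proof.
apply: abs_cont_C1 (is_derive_spiral a b u v i) _.
(* The derivative is itself a combination of spirals, which are continuous because they are
   differentiable. *)
have -> : (fun t => expR (a * t) * (a * (cos (b * t) * u i 0 - sin (b * t) * v i 0)
       - b * (sin (b * t) * u i 0 + cos (b * t) * v i 0))) =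
   (fun t => a * spiral a b u v t i 0 - b * spiral a b v (- u) t i 0).
  by apply/funext => t; rewrite /spiral !mxE; ring.
have cs u' v' : continuous (fun t => spiral a b u' v' t i 0).
  move=> t; have /derivable1_diffP/differentiable_continuous :=
    @ex_derive _ _ _ _ _ _ _ (is_derive_spiral a b u' v' i t).
  exact.
by move=> t; apply: cvgB; apply: cvgMl_tmp; exact: cs.
Qed.

(** The two spirals are the real and imaginary parts of [u + i v] multiplied by the nonzero number
    [exp((a + i b) t)]; the proof inverts the rotation. *)
Lemma spiral_pair_eq0 (R : realType) (n : nat) (a b t : R) (u v : 'cV[R]_n) :
  spiral a b u v t = 0 -> spiral a b v (- u) t = 0 -> u = 0 /\ v = 0.
Proof.
have e0 : expR (a * t) != 0 by rewrite gt_eqF// expR_gt0.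
move=> /eqP; rewrite scaler_eq0 (negPf e0) /= => /eqP /matrixP H1.
move=> /eqP; rewrite scaler_eq0 (negPf e0) /= => /eqP /matrixP H2.
have cs := cos2Dsin2 (b * t).
split; apply/matrixP => i j; have := H1 i j; have := H2 i j; rewrite !mxE => h2 h1.
- have -> : u i j = (cos (b * t) ^+ 2 + sin (b * t) ^+ 2) * u i j by rewrite cs mul1r.
  have -> : (cos (b * t) ^+ 2 + sin (b * t) ^+ 2) * u i j =
   cos (b * t) * (cos (b * t) * u i j - sin (b * t) * v i j) +
   sin (b * t) * (cos (b * t) * v i j - sin (b * t) * - u i j) by ring.
  by rewrite h1 h2 !mulr0 addr0.
- have -> : v i j = (cos (b * t) ^+ 2 + sin (b * t) ^+ 2) * v i j by rewrite cs mul1r.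
  have -> : (cos (b * t) ^+ 2 + sin (b * t) ^+ 2) * v i j =
   cos (b * t) * (cos (b * t) * v i j - sin (b * t) * - u i j) -
   sin (b * t) * (cos (b * t) * u i j - sin (b * t) * v i j) by ring.
  by rewrite h1 h2 !mulr0 subr0.
Qed.

(** * Sliding solutions inside the kernel of [C] *)

Section SlidingSolution.
Variables (R : realType) (n p : nat) (A : 'M[R]_n) (B : 'M[R]_(n, p)).
Variables (C : 'M[R]_(p, n)) (psi : 'I_p -> R -> R).

(** The closed loop under the equivalent control of sliding mode theory, the input that keeps the
    output constant. *)
Definition sliding_mx : 'M[R]_n := A - B *m (invmx (C *m B) *m (C *m A)).

Lemma mulmx_sliding_mx : C *m B \in unitmx -> C *m sliding_mx = 0.
Proof. by move=> CB; rewrite mulmxBr !mulmxA mulmxV// mul1mx subrr. Qed.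

(** On the kernel of [C] every input with entries in [[-m, m]] is admissible, and the equivalent
    control is linear in the state, hence small near the origin. *)
Lemma KrasF_sliding (m : R) (lneg lpos : 'I_p -> R) :
  0 < m -> (forall i, m <= lpos i /\ lneg i <= - m) ->
  (forall i w, lneg i <= w <= lpos i -> kras (psi i) 0 w) ->
  exists2 r, 0 < r & forall z, `|z| <= r -> C *m z = 0 -> KrasF A B C psi z (sliding_mx *m z).
Proof.
move=> m0 lm kl.
have [K K0 HK] := mulmx_norm_le 1 (invmx (C *m B) *m (C *m A)).
have K1 : 0 < K + 1 by lra.
exists (m / (K + 1)) => [|z zr Cz]; first exact: divr_gt0.
exists (invmx (C *m B) *m (C *m A) *m z); split; last first.
  by rewrite mulmxBl !mulmxA.
move=> i; rewrite {1}Cz [X in kras _ X]mxE; apply: kl.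
have := mx_entry_le_norm (invmx (C *m B) *m (C *m A) *m z) i 0.
have : K * `|z| <= m.
  move: zr; rewrite ler_pdivlMr// => zr; have := normr_ge0 z; lra.
have := HK z; have [] := lm i.
move: (X in X i 0) => w h1 h2 h3 h4 h5.
by have : `|w i 0| <= m; [lra | rewrite ler_norml; lra].
Qed.

(** The stability bound applies only to solutions, while the scaled motion is known to be one only
    as long as it is small. A continuation argument breaks the circle: a bound by [r] makes it a
    solution, and [beta] then improves the bound to [r / 2]. *)
Lemma GAS_stays_small (r : R) (x : R -> 'cV[R]_n) :
  GAS A B C psi -> 0 < r ->
  (forall t : R, derivable x t 1) ->
  (forall t i, abs_cont_on 0 t (fun s => x s i 0)) ->
  (forall (s t : R), `|s *: x t| <= r ->
     KrasF A B C psi (s *: x t) ('D_1 (fun t => s *: x t) t)) ->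
  exists2 s, 0 < s & is_solution A B C psi +oo%E (fun t => s *: x t).
Proof.
move=> [_ [beta [[Kb KL] Hb]]] r0 dx acx Fx.
have [b0 [bc bi]] := Kb 0 (lexx 0).
have r2 : 0 < r / 2 by lra.
have [d d0 Hd] : exists2 d, 0 < d & forall e, 0 <= e -> e < d -> beta e 0 < r / 2.
  have E : [set w : R | 0 <= w] = `[0, +oo[.
    by apply/seteqP; split=> w /=; rewrite in_itv/= andbT.
  move: bc; rewrite E => /continuous_within_itvcyP[_ /cvgrPdist_lt/(_ _ r2)[d /= d0 Hd]].
  exists d => // e e0 ed; have [->|e1] := eqVneq e 0; first by rewrite b0.
  have := Hd e; rewrite /ball_/= b0 !sub0r !normrN (ger0_norm e0) => /(_ ed).
  rewrite lt_neqAle (eq_sym 0) e1 e0 => /(_ isT); apply: le_lt_trans; exact: ler_norm.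
(* The scaled initial state has norm below [d], where [beta] is less than [r / 2], and at most
   [r / 4], which starts the induction. *)
pose s := Num.min (d / 2) (r / 4) / (enorm (x 0) + 1).
have n0 : 0 <= enorm (x 0) by exact: sqrtr_ge0.
have n1 : 0 < enorm (x 0) + 1 by lra.
have s0 : 0 < s by rewrite divr_gt0// lt_min; lra.
have snE : enorm (s *: x 0) = s * enorm (x 0).
  rewrite /enorm; under eq_bigr do rewrite mxE exprMn.
  by rewrite -mulr_sumr sqrtrM ?sqr_ge0// sqrtr_sqr gtr0_norm.
have sn : s * enorm (x 0) <= Num.min (d / 2) (r / 4).
  rewrite /s mulrAC ler_pdivrMr// ler_wpM2l//; last by lra.
  by rewrite le_min; lra.
have snd : s * enorm (x 0) < d by apply: (le_lt_trans sn); rewrite gt_min; lra.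
have snr : s * enorm (x 0) <= r / 4 by apply: (le_trans sn); rewrite ge_min lexx orbT.
have sn0 : 0 <= s * enorm (x 0) by rewrite mulr_ge0// ltW.
have sol (T : \bar R) : (0 < T)%E ->
    (forall t, 0 <= t -> (t%:E < T)%E -> `|s *: x t| <= r) ->
    is_solution A B C psi T (fun t => s *: x t).
  move=> T0 xT; split=> //; split=> [t t0 tT i|].
    apply: (@abs_cont_lipschitz_comp _ _ _ `|s| (fun s => x s i 0)) => // t1 t2 _ _.
    by rewrite !mxE -mulrBr normrM.
  apply: aeW => t t0 tT; split; first exact: derivableZ.
  by apply: Fx; exact: xT.
have small t : 0 <= t -> `|s *: x t| <= r / 2.
  move=> t0; suff : forall u, 0 <= u <= t -> `|s *: x u| <= r / 2 by apply; rewrite t0 lexx.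
  apply: (@real_induction R (fun t => forall u, 0 <= u <= t -> `|s *: x u| <= r / 2) 0 t t0).
    move=> u u0; have -> : u = 0 by lra.
    by apply: (le_trans (mx_norm_le_enorm _)); rewrite snE; lra.
  move=> c /andP[c0 ct].
  have /cvgrPdist_le : (fun u => s *: x u) u @[u --> c] --> s *: x c.
    have /derivable1_diffP/differentiable_continuous : derivable (fun u => s *: x u) c 1.
      exact: derivableZ.
    exact.
  have r4 : 0 < r / 4 by lra.
  move=> /(_ _ r4)[e /= e0 He].
  have {}He u : `|u - c| < e -> `|s *: x c - s *: x u| <= r / 4.
    by move=> uc; apply: He; rewrite /= distrC.
  exists e => // a' b' a0 ac cb _ ca bc' Pa u /andP[u0 ub].
  have ce : (0 < (c + e)%:E)%E by rewrite lte_fin; lra.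
  (* Beyond [a'] the norm is at most [r / 2 + r / 4 + r / 4 = r], so the motion is still a solution
     up to time [c + e]. *)
  have solT : is_solution A B C psi (c + e)%:E (fun t => s *: x t).
    apply: sol => // w w0; rewrite lte_fin => wce.
    have [wa|aw] := leP w a'; first by apply: (le_trans (Pa w _)); lra.
    have h1 : `|s *: x c - s *: x w| <= r / 4 by apply: He; rewrite ltr_norml; lra.
    have h2 : `|s *: x c - s *: x a'| <= r / 4 by apply: He; rewrite ltr_norml; lra.
    have h3 : `|s *: x a'| <= r / 2 by apply: Pa; lra.
    have : s *: x w = s *: x a' + (s *: x c - s *: x a') - (s *: x c - s *: x w).
      by rewrite (addrC (s *: x a')) subrK subKr.
    move=> ->; apply: (le_trans (ler_normB _ _)).
    by have := ler_normD (s *: x a') (s *: x c - s *: x a'); lra.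
  apply: (le_trans (mx_norm_le_enorm _)).
  have uT : (u%:E < (c + e)%:E)%E by rewrite lte_fin; lra.
  apply: (le_trans (Hb _ _ solT u u0 uT)); rewrite snE.
  apply: (le_trans ((KL _ sn0).1 0 u (lexx 0) u0)).
  by apply/ltW/Hd.
exists s => //; apply: sol => // t t0 _.
by apply: (le_trans (small t t0)); lra.
Qed.

End SlidingSolution.

(** * The equivalence *)

Lemma castmx_unitmx (F : fieldType) (p n : nat) (e : p = n) (C : 'M[F]_(p, n)) :
  (castmx (e, erefl n) C \in unitmx) = row_free C.
Proof. by case: _ / e C => C; rewrite castmx_id row_free_unit. Qed.

Theorem theorem3 (R : realType) (n p : nat) (A : 'M[R]_n) (B : 'M[R]_(n, p))
  (C : 'M[R]_(p, n)) (psi : 'I_p -> R -> R) :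
  Assumption1 psi -> Assumption3 A B C psi ->
  (SFTS A B C psi <-> exists e : p = n, castmx (e, erefl n) C \in unitmx).
Proof.
move=> _ H3; have [[G [dG [pG pM]]] [hGAS Hpsi]] := H3.
split=> [[_ [_ Hft]]|[e Cu]]; last first.
  split; first by case: hGAS.
  split=> // T x solx.
  (* On a finite horizon [T], the choice [Tc = T] makes the claim vacuous. *)
  case: T solx => [T||] solx; last by have [] := solx.
    exists T; split; first by have [+ _] := solx; rewrite lte_fin => /ltW.
    by move=> t Tt; rewrite lte_fin ltNge Tt.
  have Cinj (z : 'cV_n) : C *m z = 0 -> z = 0.
    move: Cu; rewrite castmx_unitmx; clear -e; case: _ / e C z => C z.
    by rewrite row_free_unit => Cu Cz; rewrite -[z](mulKmx Cu) Cz mulmx0.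
  have [Tc [Tc0 HTc]] := finite_time_convergence Cinj H3 solx.
  by exists Tc; split=> // t Tt _; exact: HTc.
have CB := posdef_sym_unit dG pM.
(* The rank of [C] is at least that of the invertible product [C *m B]. *)
have rC : \rank C = p.
  apply/eqP; rewrite eqn_leq rank_leq_row /=.
  by rewrite -[X in (X <= _)%N](mxrank_unit CB) mxrankM_maxl.
have pn : (p <= n)%N by rewrite -rC rank_leq_col.
have [epn|ltpn] := eqVneq p n.
  by exists epn; rewrite castmx_unitmx /row_free rC.
have {}ltpn : (p < n)%N by rewrite ltn_neqAle ltpn.
have [a [b [u [v [Su Sv Cu Cv uv]]]]] := invariant_eigenpair (mulmx_sliding_mx A CB) ltpn.
have [lpos [lneg [m m0 [lm kl _]]]] := sliding_limits Hpsi.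
have [r r0 Hr] := KrasF_sliding A B C m0 lm kl.
(* Finite-time stability kills a scaled copy of the spiral, hence the spiral. It is applied to both
   the real and the imaginary part, since one of them alone may be identically zero. *)
have vanish u' v' : sliding_mx A B C *m u' = a *: u' - b *: v' ->
    sliding_mx A B C *m v' = b *: u' + a *: v' -> C *m u' = 0 -> C *m v' = 0 ->
    exists Tc, forall t, Tc <= t -> spiral a b u' v' t = 0.
  move=> Su' Sv' Cu' Cv'.
  have [|t i|s t st|s s0 sol] := @GAS_stays_small R n p A B C psi r (spiral a b u' v') hGAS r0.
  - exact: derivable_spiral.
  - exact: abs_cont_spiral.
  - rewrite deriveZ; last exact: derivable_spiral.
    rewrite (derive_spiral t Su' Sv') scalemxAr; apply: Hr => //.
    by rewrite -scalemxAr spiral_mulmx0// scaler0.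
  have [Tc [_ HTc]] := Hft _ _ sol; exists Tc => t Tt.
  by have /eqP := HTc t Tt (ltry t); rewrite scaler_eq0 gt_eqF//= => /eqP.
have [T1 HT1] := vanish u v Su Sv Cu Cv.
(* The pair [v], [- u] comes from the eigenvector [- i (u + i v)], for the same eigenvalue. *)
have Su' : sliding_mx A B C *m (- u) = b *: v + a *: (- u).
  by rewrite mulmxN Su opprB scalerN.
have Sv' : sliding_mx A B C *m v = a *: v - b *: (- u).
  by rewrite Sv scalerN opprK addrC.
have Cu' : C *m (- u) = 0 by rewrite mulmxN Cu oppr0.
have [T2 HT2] := vanish v (- u) Sv' Su' Cv Cu'.
have T1T : T1 <= Num.max T1 T2 by rewrite le_max lexx.
have T2T : T2 <= Num.max T1 T2 by rewrite le_max lexx orbT.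
have [u0 v0] := spiral_pair_eq0 (HT1 _ T1T) (HT2 _ T2T).
by move: uv; rewrite u0 v0 eqxx.
Qed.
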